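(* Let $X$ be a set, let $Y$ be a locally compact Hausdorff space, and for each $x\in X$ let $\mu_x$ be a finite positive regular Borel measure on the Borel $\sigma$-algebra of $Y$. Let $\mathcal{K}$ be a real $(m\times m)$-matrix-valued function on $X\times Y$ such that for each $x\in X$ the elements of $\mathcal{K}(x,\cdot)$ are Borel and bounded on $Y$, and $$\int_Y\mathcal{K}(x,y)\,d\mu_x(y)=I\qquad\text{for every }x\in X,$$ where $I$ is the identity $(m\times m)$-matrix. For bounded Borel functions $\boldsymbol u:Y\to\mathbb{R}^m$ put $$(T\boldsymbol u)(x)=\int_Y\mathcal{K}(x,y)\boldsymbol u(y)\,d\mu_x(y),\qquad x\in X.$$ Let $\mathfrak{S}$ be a convex body in $\mathbb{R}^m$. Then $\mathfrak{S}$ is invariant for the transform $T$ if and only if there exists a bounded non-negative function $g:X\times Y\times\mathfrak{N}_{\mathfrak{S}}\to\mathbb{R}$ such that for every $x\in X$ and every $\boldsymbol\nu\in\mathfrak{N}_{\mathfrak{S}}$, $${}^t\mathcal{K}(x,y)\boldsymbol\nu=g(x,y;\boldsymbol\nu)\boldsymbol\nu$$ for almost all $y\in Y$ (with respect to $\mu_x$).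
   Context: ${}^t\mathcal{K}$ is the transpose of the matrix $\mathcal{K}$. Convex body: a convex body $\mathfrak{S}$ in $\mathbb{R}^m$ is the closure of an arbitrary convex proper subdomain of $\mathbb{R}^m$ (nonempty open convex set, not all of $\mathbb{R}^m$); it may be unbounded. $\partial^*\mathfrak{S}$ is the set of points $a\in\partial\mathfrak{S}$ at which the unit outward normal $\boldsymbol\nu(a)$ to $\partial\mathfrak{S}$ exists, and $\mathfrak{N}_{\mathfrak{S}}=\{\boldsymbol\nu(a):a\in\partial^*\mathfrak{S}\}$. Invariance: $\mathfrak{S}$ is invariant for the integral transform $T$ if $(T\boldsymbol u)(x)\in\mathfrak{S}$ for all $x\in X$ and every bounded Borel function $\boldsymbol u:Y\to\mathbb{R}^m$ which takes values in $\mathfrak{S}$.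
   Formalization: With K(x,·) bounded only for each x, a g bounded on all of X×Y×N_S need not exist (m=1, S=[0,∞), μ_n=Lebesgue/n on [0,1], K=n); the theorem proved has g bounded for each fixed x, and g bounded on X×Y×N_S when K is bounded on X×Y. *)

(* Defs.v *)
(* MathComp / MathComp-Analysis *)
From HB Require Import structures.
From mathcomp Require Import all_boot all_order all_algebra.
From mathcomp Require Import all_classical all_reals all_analysis.

Set Implicit Arguments.
Unset Strict Implicit.
Unset Printing Implicit Defensive.

Import Order.TTheory GRing.Theory Num.Theory.
Import numFieldNormedType.Exports.

Local Open Scope classical_set_scope.
Local Open Scope ring_scope.

(* Measurable types are pointed in the library, hence ptopologicalType; an
   empty Y would admit no K with integral 1%:M, unless X is empty too. *)
Notation borel T := (g_sigma_algebraType (@open T)).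

Definition regular_measure (R : realType) (Y : ptopologicalType)
    (mu : {finite_measure set (borel Y) -> \bar R}) : Prop :=
  forall A : set (borel Y), measurable A ->
    mu A = ereal_inf [set mu U | U in [set U : set Y | open U /\ A `<=` U]] /\
    mu A = ereal_sup [set mu C | C in [set C : set Y | compact C /\ C `<=` A]].

Section ConvexBodies.
Context {R : realType} {m : nat}.
Implicit Types (S D : set 'cV[R]_m) (a nu : 'cV[R]_m).

Definition convex_body S : Prop :=
  exists D, [/\ D !=set0, open D, D <> setT,
    convex_set (D : set (convex_lmodType 'cV[R]_m)) & S = closure D].

Definition boundary S : set 'cV[R]_m := closure S `\` interior S.

Definition dot (u v : 'cV[R]_m) : R := \sum_i u i ord0 * v i ord0.

Definition unit_outward_normal S a nu : Prop :=
  dot nu nu = 1 /\ forall s, S s -> dot nu (s - a) <= 0.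

(* A convex body has a supporting hyperplane at each boundary point; "the"
   unit outward normal at a exists when there is exactly one. *)
Definition is_normal_at S a nu : Prop :=
  unit_outward_normal S a nu /\
  forall nu', unit_outward_normal S a nu' -> nu' = nu.

Definition smooth_boundary S : set 'cV[R]_m :=
  [set a | boundary S a /\ exists nu, is_normal_at S a nu].

Definition normals S : set 'cV[R]_m :=
  [set nu | exists2 a, smooth_boundary S a & is_normal_at S a nu].

End ConvexBodies.

Section Transform.
Context {R : realType} {m : nat} {X : Type} {Y : ptopologicalType}.
Variables (mu : X -> {finite_measure set (borel Y) -> \bar R}).
Variable (K : X -> Y -> 'M[R]_m).

Definition integral_mx (x : X) : 'M[R]_m :=
  \matrix_(i, j) \int[mu x]_(y in setT) K x y i j.

Definition transform (u : Y -> 'cV[R]_m) (x : X) : 'cV[R]_m :=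
  \col_i \int[mu x]_(y in setT) (K x y *m u y) i ord0.

Definition invariant_body (S : set 'cV[R]_m) : Prop :=
  forall u : Y -> 'cV[R]_m,
    measurable_fun setT (u : borel Y -> borel 'cV[R]_m) ->
    bounded_fun u ->
    (forall y, S (u y)) ->
    forall x, S (transform u x).

(* No measurability of g is assumed: "almost all y" means outside a subset of
   a Borel mu x-null set. *)
Definition normals_are_eigenvectors (S : set 'cV[R]_m)
    (g : X -> Y -> normals S -> R) : Prop :=
  forall (x : X) (nu : normals S),
    {ae mu x, forall y : borel Y,
      (K x y)^T *m \val nu = g x y nu *: \val nu}.

End Transform.

(* Main.v *)
(* Since [K x] has integral [1], for [u] with values in [S] and a boundary point
   [a] with outward normal [nu] one has
   [nu . (T u x - a) = \int (K^T nu) . (u y - a)].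

   If [K^T nu = g nu] almost everywhere with [g >= 0], the integrand is [<= 0],
   so [T u x] lies in the supporting half-space at every smooth boundary point.
   These half-spaces cut out [S]: each point [z] outside [S] is separated from
   [S] by the tangent plane at a contact point of a small ball inscribed in [S],
   and at such a point the normal is unique.

   Conversely, testing with [u y = s] where [(K^T nu) . (s - a) > 0] and
   [u y = a] elsewhere gives [(K^T nu) . (s - a) <= 0] almost everywhere, and
   simultaneously for all [s] in [S] by countable density; so [K^T nu] lies in
   the normal cone of [S] at [a], which is the ray spanned by [nu]. *)
Require Import Defs.
From HB Require Import structures.
From mathcomp Require Import all_boot all_order all_algebra.
From mathcomp Require Import all_classical all_reals all_analysis.
From mathcomp Require Import ring lra measurable_realfun.
Import Order.TTheory GRing.Theory Num.Theory.
Import numFieldNormedType.Exports.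
Local Open Scope classical_set_scope.
Local Open Scope ring_scope.

(** * The Euclidean inner product on columns *)

Lemma dotC {R : realType} {m : nat} (u v : 'cV[R]_m) : dot u v = dot v u.
Proof. by apply: eq_bigr => i _; rewrite mulrC. Qed.

Lemma dotDr {R : realType} {m : nat} (u v w : 'cV[R]_m) :
  dot u (v + w) = dot u v + dot u w.
Proof. by rewrite /dot -big_split; apply: eq_bigr => i _; rewrite mxE mulrDr. Qed.

Lemma dotZr {R : realType} {m : nat} (k : R) (u v : 'cV[R]_m) :
  dot u (k *: v) = k * dot u v.
Proof. by rewrite /dot mulr_sumr; apply: eq_bigr => i _; rewrite mxE mulrCA. Qed.

Lemma dotNr {R : realType} {m : nat} (u v : 'cV[R]_m) : dot u (- v) = - dot u v.
Proof. by rewrite -scaleN1r dotZr mulN1r. Qed.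

Lemma dotBr {R : realType} {m : nat} (u v w : 'cV[R]_m) :
  dot u (v - w) = dot u v - dot u w.
Proof. by rewrite dotDr dotNr. Qed.

Lemma dotDl {R : realType} {m : nat} (u v w : 'cV[R]_m) :
  dot (u + v) w = dot u w + dot v w.
Proof. by rewrite dotC dotDr !(dotC w). Qed.

Lemma dotZl {R : realType} {m : nat} (k : R) (u v : 'cV[R]_m) :
  dot (k *: u) v = k * dot u v.
Proof. by rewrite dotC dotZr dotC. Qed.

Lemma dotNl {R : realType} {m : nat} (u v : 'cV[R]_m) : dot (- u) v = - dot u v.
Proof. by rewrite dotC dotNr dotC. Qed.

Lemma dotBl {R : realType} {m : nat} (u v w : 'cV[R]_m) :
  dot (u - v) w = dot u w - dot v w.
Proof. by rewrite dotDl dotNl. Qed.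

Lemma dot_ge0 {R : realType} {m : nat} (u : 'cV[R]_m) : 0 <= dot u u.
Proof. by apply: sumr_ge0 => i _; rewrite -expr2 sqr_ge0. Qed.

Lemma coord_le_dot {R : realType} {m : nat} (u : 'cV[R]_m) i :
  u i ord0 ^+ 2 <= dot u u.
Proof.
rewrite /dot (bigD1 i)//= -expr2 lerDl; apply: sumr_ge0 => j _.
by rewrite -expr2 sqr_ge0.
Qed.

Lemma dot_eq0 {R : realType} {m : nat} (u : 'cV[R]_m) : dot u u = 0 -> u = 0.
Proof.
move=> u0; apply/matrixP => i j; rewrite ord1 mxE; apply/eqP.
by rewrite -sqrf_eq0 eq_le sqr_ge0 andbT -u0 coord_le_dot.
Qed.

Lemma dot_gt0 {R : realType} {m : nat} (u : 'cV[R]_m) : u != 0 -> 0 < dot u u.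
Proof.
move=> u0; rewrite lt_neqAle dot_ge0 andbT eq_sym.
by apply: contra u0 => /eqP /dot_eq0 ->.
Qed.

(** Once [dot p q] is read as the only entry of [p^T *m q], the adjunction is associativity of the
    matrix product. *)
Lemma dot_mulmx {R : realType} {m : nat} (A : 'M[R]_m) (u v : 'cV[R]_m) :
  dot u (A *m v) = dot (A^T *m u) v.
Proof.
have dotE (p q : 'cV[R]_m) : dot p q = (p^T *m q) ord0 ord0.
  by rewrite /dot mxE; apply: eq_bigr => i _; rewrite mxE.
by rewrite !dotE trmx_mul trmxK mulmxA.
Qed.

Lemma continuous_dot {R : realType} {m : nat} (T : topologicalType)
    (f g : T -> 'cV[R]_m) (t : T) :
  {for t, continuous f} -> {for t, continuous g} ->
  {for t, continuous (fun s => dot (f s) (g s))}.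
Proof.
move=> cf cg; rewrite /dot.
apply: cvg_big => [|i _]; first exact: add_continuous.
apply: cvgM.
- apply: (@continuous_comp _ _ _ f (fun M : 'cV[R]_m => M i ord0)) => //.
  exact: coord_continuous.
- apply: (@continuous_comp _ _ _ g (fun M : 'cV[R]_m => M i ord0)) => //.
  exact: coord_continuous.
Qed.

(** * Segments, convex combinations and interiors *)

Lemma nbhs_line {R : realType} {V : normedModType R} (a v : V) (B : set V) :
  nbhs a B -> \forall k \near (0 : R), B (a + k *: v).
Proof.
move=> aB.
have : (fun k : R => a + k *: v) @ (0 : R) --> a + (0 : R) *: v.
  apply: cvgD; first exact: cvg_cst.
  by apply: cvgZr_tmp; exact: cvg_id.
by rewrite scale0r addr0; apply.
Qed.

Lemma nbhs_ray {R : realType} {V : normedModType R} (a v : V) (B : set V) (e : R) :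
  nbhs a B -> 0 < e -> exists2 k, 0 < k < e & B (a + k *: v).
Proof.
move=> /(nbhs_line a v) /nbhs_ballP[d /= d0 dB] e0.
have h0 : 0 < Num.min d e by rewrite lt_min d0.
exists (Num.min d e / 2).
  rewrite divr_gt0//= ltr_pdivrMr// (le_lt_trans (y := e))//.
  - by rewrite ge_min lexx orbT.
  - lra.
apply: dB; rewrite /ball /= sub0r normrN gtr0_norm ?divr_gt0//.
rewrite ltr_pdivrMr// (le_lt_trans (y := d))// ?ge_min ?lexx//; lra.
Qed.

(** Convexity with the weight as a plain scalar and two inequalities, instead of the bundled
    unit-interval element used by [convex_set]. *)
Definition convex_comb_closed {R : realType} {V : lmodType R} (S : set V) : Prop :=
  forall (k : R) (x y : V), 0 <= k <= 1 -> S x -> S y -> S (k *: x + (1 - k) *: y).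

Lemma convex_comb_closure {R : realType} {V : normedModType R} (D : set V) :
  convex_set (D : set (convex_lmodType V)) -> convex_comb_closed (closure D).
Proof.
move=> cD k x y k01 Dx Dy B.
have : (fun z : V * V => k *: z.1 + (1 - k) *: z.2) @ (x, y) -->
    k *: x + (1 - k) *: y.
  apply: cvgD; apply: cvgZ; [exact: cvg_cst|exact: cvg_fst|exact: cvg_cst|exact: cvg_snd].
move=> /[apply] -[[B1 B2] /= [/Dx[p [Dp B1p]] /Dy[q [Dq B2q]]] B12].
exists (k *: p + (1 - k) *: q); split; last by apply: (B12 (p, q)).
case/andP: k01 => k0 k1.
have := cD p q (Itv01 k0 k1); rewrite !inE; exact.
Qed.

(** The homothety [f] undoes [x |-> k *: s + (1 - k) *: x] and sends the combination to [p]. Points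
    near the combination are thus sent near [p], into [S], and combining them back with [s] stays in
    [S]. *)
Lemma convex_comb_interior {R : realType} {V : normedModType R} (S : set V)
    (k : R) (s p : V) :
  convex_comb_closed S -> 0 <= k < 1 -> S s -> interior S p ->
  interior S (k *: s + (1 - k) *: p).
Proof.
move=> cS /andP[k0 k1] Ss Sp; set a := k *: s + _.
have k1N : 1 - k != 0 by rewrite gt_eqF// subr_gt0.
pose f (x : V) := (1 - k)^-1 *: (x - k *: s).
have fa : f a = p by rewrite /f /a addrAC subrr add0r scalerA mulVf// scale1r.
have : f x @[x --> a] --> f a.
  apply: cvgZ; first exact: cvg_cst.
  by apply: cvgB; [exact: cvg_id|exact: cvg_cst].
rewrite fa => /(_ _ Sp) Sfa; have {Sfa} : nbhs a (f @^-1` S) by [].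
apply: (@filterS _ (nbhs a)) => x /= Sfx.
suff -> : x = k *: s + (1 - k) *: f x by apply: cS => //; rewrite k0 ltW.
by rewrite /f scalerA mulfV// scale1r addrC subrK.
Qed.

(** * Euclidean balls, nearest points and separation by smooth boundary points *)

Lemma sqdot_subZ {R : realType} {m : nat} (k : R) (v w : 'cV[R]_m) :
  dot (v - k *: w) (v - k *: w) =
  dot v v - 2 * k * dot v w + k ^+ 2 * dot w w.
Proof. by rewrite !(dotBl, dotBr, dotZl, dotZr) (dotC w); ring. Qed.

Lemma continuous_subr {R : realType} {V : normedModType R} (c : V) :
  continuous (fun x : V => x - c).
Proof. by move=> x; apply: cvgB; [exact: cvg_id|exact: cvg_cst]. Qed.

(** Compares two norms: [ball] refers to the maximum norm, which is dominated by the Euclidean norm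
    coming from [dot]. *)
Lemma ball_of_dot_lt {R : realType} {m : nat} (u v : 'cV[R]_m) (e : R) :
  0 < e -> dot (u - v) (u - v) < e ^+ 2 -> ball u e v.
Proof.
move=> e0 uve; split => // i j; rewrite ord1 -ball_normE /= /ball_ /=.
rewrite -(ltr_pXn2r (n := 2)) ?nnegrE ?(ltW e0)// real_normK ?num_real//.
by apply: le_lt_trans uve; rewrite -[leLHS]/((u i ord0 - v i ord0) ^+ 2);
  have := coord_le_dot (u - v) i; rewrite !mxE.
Qed.

Lemma nbhs_dot_ball {R : realType} {m : nat} (d : 'cV[R]_m) (S : set 'cV[R]_m) :
  nbhs d S -> exists2 r, 0 < r & forall v, dot v v <= r ^+ 2 -> S (d + v).
Proof.
move=> /nbhs_ballP[e /= e0 eS]; exists (e / 2); first by rewrite divr_gt0.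
move=> v ve; apply: eS; apply: ball_of_dot_lt => //.
rewrite opprD addNKr dotNl dotNr opprK (le_lt_trans ve)//.
by rewrite ltr_pXn2r// ?nnegrE; lra.
Qed.

(** The minimum is sought among the points of [F] no farther from [c] than [b], a compact set.
    Transposition carries it to row vectors, where Heine-Borel and the extreme value theorem are
    stated. *)
Lemma exists_nearest {R : realType} {m : nat} (F : set 'cV[R]_m) (c : 'cV[R]_m) :
  closed F -> F !=set0 ->
  exists2 a, F a & forall x, F x -> dot (a - c) (a - c) <= dot (x - c) (x - c).
Proof.
move=> cF [b Fb]; pose q (x : 'cV[R]_m) := dot (x - c) (x - c).
have cq : continuous q.
  move=> x; have cB : continuous (fun y : 'cV[R]_m => y - c) by exact: continuous_subr.
  exact (continuous_dot _ _ _ _ (cB x) (cB x)).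
have cT : continuous (trmx : 'rV[R]_m -> 'cV[R]_m).
  move=> w B /nbhs_ballP[e /= e0 eB]; apply/nbhs_ballP; exists e => // w' [_ ww'].
  by apply: eB; split => // i j; rewrite !mxE; exact: ww'.
pose A := [set w : 'rV[R]_m | F w^T /\ q w^T <= q b].
have A0 : A !=set0 by exists b^T; rewrite /A /= trmxK.
have bA : bounded_set A.
  (* A squared distance at most [q b] is below [(q b + 1) ^+ 2], so [q b + 1] serves as a radius
     around [c]. *)
  exists (q b + 1 + `|c^T|); split; first exact: num_real.
  move=> M qM w [_ wb]; apply: le_trans (ltW qM).
  rewrite -lerBlDr; apply: le_trans (lerB_dist _ _) _; apply/ltW.
  have q0 : 0 <= q b by exact: dot_ge0.
  suff : ball c^T (q b + 1) w by rewrite -ball_normE /= distrC.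
  split=> [|i j]; first by rewrite ltr_wpDl.
  have : ball c (q b + 1) w^T.
    apply: ball_of_dot_lt; first by rewrite ltr_wpDl.
    rewrite -opprB dotNl dotNr opprK; apply: le_lt_trans wb _; nra.
  by move=> [_ /(_ j i)]; rewrite !mxE.
have cA : closed A.
  apply: closedI; first by apply: closed_comp => // w _; exact: cT.
  apply: (@closed_comp _ _ (q \o trmx) [set r | r <= q b]); last exact: closed_le.
  by move=> w _; apply: continuous_comp; [exact: cT|exact: cq].
have [a /[!inE] -[Fa ab] amin] : exists2 a, a \in A & forall t, t \in A -> q a^T <= q t^T.
  apply: (@EVT_min_rV _ _ (q \o trmx)) => //; first exact: bounded_closed_compact.
  apply: continuous_subspaceT => w; apply: continuous_comp; [exact: cT|exact: cq].
exists a^T => // x Fx; have [xb|/ltW xb] := leP (q x) (q b).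
- by have := amin x^T; rewrite inE /A /= trmxK; exact.
- exact: le_trans ab xb.
Qed.

(* The ball around [c] through its nearest point [a] outside the interior lies
   in [S], so that every outward normal of [S] at [a] is the one of the ball. *)
Lemma nearest_is_normal_at {R : realType} {m : nat} (S : set 'cV[R]_m)
    (c a : 'cV[R]_m) :
  convex_comb_closed S -> interior S c -> ~ interior S a ->
  (forall x, ~ interior S x -> dot (a - c) (a - c) <= dot (x - c) (x - c)) ->
  boundary S a /\
  is_normal_at S a ((Num.sqrt (dot (a - c) (a - c)))^-1 *: (a - c)).
Proof.
move=> cS Sc Sa amin; set v := a - c; set rho := Num.sqrt _.
have v0 : 0 < dot v v.
  by apply: dot_gt0; apply: contra_notN Sa => /eqP/subr0_eq ->.
have rho0 : 0 < rho by rewrite sqrtr_gt0.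
have rho2 : dot v v = rho ^+ 2 by rewrite sqr_sqrtr ?ltW.
have inS x : dot (x - c) (x - c) < dot v v -> interior S x.
  by move=> xv; apply: contrapT => /amin; rewrite leNgt xv.
split; [split => //|split; [split|]].
(* A small move from [a] towards [c] shrinks [v] by the factor [1 - k] and enters the open ball. *)
- move=> B aB; have [k /andP[k0 k1] Bk] := nbhs_ray a (- v) B 1 aB ltr01.
  exists (a + k *: - v); split => //; apply: interior_subset; apply: inS.
  have -> : a + k *: - v - c = (1 - k) *: v.
    by rewrite scalerN scalerBl scale1r addrAC.
  have k2 : 0 < k * (2 - k) by rewrite mulr_gt0//; lra.
  have := mulr_gt0 k2 v0; rewrite dotZl dotZr; lra.
- rewrite dotZl dotZr rho2; field; exact: lt0r_neq0.
- move=> s Ss; rewrite dotZl -(mulr0 rho^-1) ler_pM2l ?invr_gt0// leNgt.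
  (* If [s] were strictly beyond the tangent plane, a short step from [a] away from [s] would enter
     the open ball, and [a] would be interior as a point between [s] and an interior point. With
     this [mu] the squared distance to [c] drops by exactly [mu * (mu + h)]. *)
  apply/negP => h0; apply: Sa; set h := dot v (s - a) in h0.
  pose W := dot (s - a) (s - a); pose mu := h / (W + 1).
  have W0 : 0 <= W by exact: dot_ge0.
  have mu0 : 0 < mu by rewrite divr_gt0// ltr_wpDl.
  have muW : mu * (W + 1) = h by rewrite /mu mulfVK// gt_eqF// ltr_wpDl.
  have Sp : interior S (a - mu *: (s - a)).
    apply: inS; rewrite addrAC -/v sqdot_subZ -/h -/W.
    have : 0 < mu * (mu + h) by rewrite mulr_gt0// addr_gt0.
    rewrite -muW; nra.
  have mu1 : mu + 1 != 0 by rewrite gt_eqF// addr_gt0.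
  have := convex_comb_interior S (mu / (mu + 1)) s _ cS _ Ss Sp.
  have -> : mu / (mu + 1) *: s + (1 - mu / (mu + 1)) *: (a - mu *: (s - a)) = a.
    apply/matrixP => i j; rewrite !mxE; field; exact: mu1.
  apply; rewrite divr_ge0 ?addr_ge0 ?ltW//= ltr_pdivrMr ?addr_gt0//; lra.
- move=> nu' [nu'1 nu'S].
  set nu := _ *: v.
  have vE : v = rho *: nu by rewrite /nu scalerA divff ?scale1r ?gt_eqF.
  have nu1 : dot nu nu = 1.
    by rewrite /nu dotZl dotZr rho2; field; exact: lt0r_neq0.
  have aE : a = c + rho *: nu by rewrite -vE addrC subrK.
  clearbody nu.
  have le1 : 1 <= dot nu' nu.
    have : 0 <= dot (nu + nu') (nu + nu') by exact: dot_ge0.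
    rewrite !(dotDl, dotDr) nu1 nu'1 (dotC nu) => dN1.
    (* The point of the open ball at distance [rho * l] from [c] in direction [nu'] lies in [S], yet
       beyond the plane through [a] with normal [nu'], as soon as [dot nu' nu < l < 1]. The midpoint
       is nonnegative because [dot nu' nu >= -1]. *)
    rewrite leNgt; apply/negP => d1; pose l := (1 + dot nu' nu) / 2.
    have [l0 l1 dl] : [/\ 0 <= l, l < 1 & dot nu' nu < l] by rewrite /l; split; lra.
    have /nu'S : S (c + (rho * l) *: nu').
      apply: interior_subset; apply: inS.
      rewrite addrAC subrr add0r dotZl dotZr nu'1 rho2 mulr1 -expr2.
      rewrite ltr_pXn2r ?nnegrE ?mulr_ge0 ?(ltW rho0)//; nra.
    rewrite {1}aE opprD addrACA subrr add0r dotBr !dotZr nu'1 mulr1.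
    by rewrite -mulrBr pmulr_rle0// leNgt subr_gt0 dl.
  have : dot (nu' - nu) (nu' - nu) = 0.
    apply/eqP; rewrite eq_le dot_ge0 andbT.
    rewrite !(dotBl, dotBr) nu1 nu'1 (dotC nu); lra.
  by move=> /dot_eq0 /subr0_eq.
Qed.

(* Walk from an interior point [d] towards [z] in [N] steps and stop at the last
   interior point [c]; its distance [rho] to the complement is small, so the
   tangent hyperplane at the point [a] nearest to [c], which stays at distance
   [>= r] from [d], has to cross the segment before [z]. *)
Lemma separation_by_smooth_point {R : realType} {m : nat} (S : set 'cV[R]_m)
    (d z : 'cV[R]_m) :
  convex_comb_closed S -> closed S -> interior S d -> ~ S z ->
  exists a nu, [/\ smooth_boundary S a, is_normal_at S a nu & 0 < dot nu (z - a)].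
Proof.
move=> cvS clS Sd Sz; pose w := z - d; pose p (t : R) := d + t *: w.
have [r r0 rS] := nbhs_dot_ball _ _ Sd.
(* Near [z] the segment is outside [S], so its points in [S] have parameter at most [1 - e]. *)
have [e e0 eS] : exists2 e, 0 < e & forall t, 1 - t < e -> t <= 1 -> ~ S (p t).
  have zS : nbhs z (~` S) by apply: open_nbhs_nbhs; split => //; exact: closed_openC.
  have /nbhs_ballP[e /= e0 eS] := nbhs_line z (- w) _ zS.
  exists e => // t te t1; have := eS (1 - t).
  rewrite -ball_normE /ball_ /= sub0r normrN ger0_norm ?subr_ge0// => /(_ te).
  suff -> : z + (1 - t) *: - w = p t by [].
  by rewrite /p /w; apply/matrixP => i j; rewrite !mxE; ring.
have er0 : 0 < e * r / 2 by rewrite divr_gt0// mulr_gt0.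
(* This [N] makes each of the [N] steps shorter than [e * r / 2]. *)
have [N N0 NW] : exists2 N, (0 < N)%N & dot w w < (e * r / 2 * N%:R) ^+ 2.
  set q := e * r / 2 in er0 *.
  have [N WN] : exists N, dot w w / q ^+ 2 < N%:R.
    by exists (Num.trunc (dot w w / q ^+ 2)).+1; rewrite truncnS_gt.
  have WN1 : dot w w < q ^+ 2 * N.+1%:R.
    by rewrite mulrC -ltr_pdivrMr ?exprn_gt0// (lt_le_trans WN)// ler_nat leqnSn.
  exists N.+1 => //; rewrite exprMn; apply: lt_le_trans WN1 _.
  by rewrite ler_pM2l ?exprn_gt0// -natrX ler_nat leq_pmulr.
have NR : 0 < (N%:R : R) by rewrite ltr0n.
have [k [kN Sc Sb]] : exists k, [/\ (k < N)%N, interior S (p (k%:R / N%:R)) &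
    ~ interior S (p (k.+1%:R / N%:R))].
  (* Otherwise interiority would propagate from [p 0 = d] along all steps to [p 1 = z]. *)
  apply: contrapT => H.
  have : forall k, (k <= N)%N -> interior S (p (k%:R / N%:R)).
    elim=> [_|k IH kN]; first by rewrite /p mul0r scale0r addr0.
    by apply: contrapT => Sk; apply: H; exists k; split => //; exact/IH/ltnW.
  move=> /(_ N (leqnn _)); rewrite divff ?gt_eqF// /p scale1r addrC subrK.
  by move=> /interior_subset.
set t := k%:R / N%:R in Sc; pose c := p t; pose b := p (k.+1%:R / N%:R).
have t0 : 0 <= t by rewrite divr_ge0.
have t1 : t <= 1 by rewrite ler_pdivrMr// mul1r ler_nat ltnW.
have te : e <= 1 - t.
  by rewrite leNgt; apply/negP => /eS/(_ t1); apply; exact: interior_subset.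
have [a Sa amin] := exists_nearest (~` interior S) c
  (open_closedC (@open_interior _ S)) (ex_intro _ b Sb).
have [bda na] := nearest_is_normal_at _ _ _ cvS Sc Sa amin.
set rho := Num.sqrt (dot (a - c) (a - c)) in na.
(* The next point [b] is not interior and is one step from [c], so [rho] is at most the step
   length. *)
have rho_lt : rho < e * r / 2.
  have bc : b - c = N%:R^-1 *: w.
    by rewrite /b /c /p addrAC opprD addrA subrr add0r addrC -scalerBl -mulrBl
       -natr1 addrAC subrr add0r mul1r.
  rewrite -[ltRHS](ger0_norm (ltW er0)) -sqrtr_sqr ltr_sqrt ?exprn_gt0//.
  apply: le_lt_trans (amin b Sb) _; rewrite bc dotZl dotZr mulrA -expr2 exprVn.
  by rewrite mulrC ltr_pdivrMr ?exprn_gt0// -exprMn.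
have v0 : 0 < dot (a - c) (a - c).
  apply: dot_gt0; apply/negP => /eqP/subr0_eq ac; apply: Sa; rewrite ac; exact: Sc.
have rho0 : 0 < rho by rewrite sqrtr_gt0.
set nu := _ *: _ in na; exists a, nu; split => //; first by split => //; exists nu.
have nua : dot nu (a - c) = rho.
  by rewrite dotZl -{1}(sqr_sqrtr (ltW v0)) expr2 mulKf// gt_eqF.
have [[nu1 /(_ (d + r *: nu)) nuS] _] := na; clearbody nu.
(* The ball of radius [r] around [d] lies in [S]; its extreme point in direction [nu] yields
   [r <= rho + t * dot nu w]. *)
have {}nuS : dot nu (d + r *: nu - a) <= 0.
  by apply: nuS; apply: rS; rewrite dotZl dotZr nu1 mulr1 expr2.
have rE : dot nu (d + r *: nu - a) = r - (rho + t * dot nu w).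
  have -> : d + r *: nu - a = r *: nu - ((a - c) + t *: w).
    by rewrite /c /p; apply/matrixP => i j; rewrite !mxE; ring.
  by rewrite dotBr dotDr !dotZr nu1 mulr1 nua.
have -> : z - a = (1 - t) *: w - (a - c).
  by rewrite /c /p /w; apply/matrixP => i j; rewrite !mxE; ring.
rewrite dotBr dotZr nua; rewrite rE in nuS; set g := dot nu w in nuS *.
(* The goal is [rho < (1 - t) * g]. From [t <= 1] and [nuS] comes [r - rho <= g], so the right side
   is at least [e * (r - rho) >= e * r - rho], which exceeds [rho] by the choice of [N]. *)
have e1 : e <= 1 by lra.
have er : e * r <= r by rewrite ger_pMl.
have g0 : 0 < g by rewrite ltNge; apply/negP => g0; nra.
have tg : r - rho <= g by nra.
have : e * (r - rho) <= (1 - t) * g by apply: ler_pM => //; [exact: ltW|lra].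
have : e * rho <= rho by rewrite ger_pMl.
lra.
Qed.

(** * Bounded measurable functions and their integrals *)

Definition bounded_mfun {d} {T : measurableType d} {R : realType} (f : T -> R) :=
  measurable_fun setT f /\ exists M, forall t, `|f t| <= M.

Lemma bounded_fun_le {T : Type} {R : realType} {V : normedModType R} (f : T -> V) :
  bounded_fun f -> exists M, forall t, `|f t| <= M.
Proof.
move=> [M [_ fM]]; exists (M + 1) => t.
by apply: (fM (M + 1)) => //; rewrite ltrDl.
Qed.

Lemma bounded_mfun_cst {d} {T : measurableType d} {R : realType} (k : R) :
  bounded_mfun (fun _ : T => k).
Proof. by split; [exact: measurable_cst|exists `|k|]. Qed.

Lemma bounded_mfunD {d} {T : measurableType d} {R : realType} (f g : T -> R) :
  bounded_mfun f -> bounded_mfun g -> bounded_mfun (fun t => f t + g t).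
Proof.
move=> [mf [M fM]] [mg [N gN]]; split; first exact: measurable_funD.
by exists (M + N) => t; rewrite (le_trans (ler_normD _ _))// lerD.
Qed.

Lemma bounded_mfunM {d} {T : measurableType d} {R : realType} (f g : T -> R) :
  bounded_mfun f -> bounded_mfun g -> bounded_mfun (fun t => f t * g t).
Proof.
move=> [mf [M fM]] [mg [N gN]]; split; first exact: measurable_funM.
by exists (M * N) => t; rewrite normrM ler_pM.
Qed.

Lemma bounded_mfun_sum {d} {T : measurableType d} {R : realType} (I : Type)
    (s : seq I) (f : I -> T -> R) :
  (forall i, bounded_mfun (f i)) -> bounded_mfun (fun t => \sum_(i <- s) f i t).
Proof.
move=> bf; elim: s => [|i s IH].
  by under eq_fun do rewrite big_nil; exact: bounded_mfun_cst.
by under eq_fun do rewrite big_cons; exact: bounded_mfunD.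
Qed.

Lemma bounded_mfun_integrable {d} {T : measurableType d} {R : realType}
    (mu : {finite_measure set T -> \bar R}) (f : T -> R) :
  bounded_mfun f -> mu.-integrable setT (EFin \o f).
Proof.
move=> [mf [M fM]]; apply: measurable_bounded_integrable => //.
  by rewrite ltey_eq fin_num_measure.
exists M; split; first exact: num_real.
by move=> N MN t _ /=; rewrite (le_trans (fM t))// ltW.
Qed.

Lemma Rintegral_sum {d} {T : measurableType d} {R : realType}
    (mu : {finite_measure set T -> \bar R}) (I : Type) (s : seq I)
    (f : I -> T -> R) :
  (forall i, bounded_mfun (f i)) ->
  \int[mu]_t (\sum_(i <- s) f i t) = \sum_(i <- s) \int[mu]_t f i t.
Proof.
move=> bf; elim: s => [|i s IH].
  rewrite big_nil -[RHS](mul0r (fine (mu setT))) -Rintegral_cst//.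
  by apply: eq_Rintegral => t _; rewrite big_nil.
rewrite big_cons -IH -RintegralD//.
- by apply: eq_Rintegral => t _; rewrite big_cons.
- exact: bounded_mfun_integrable.
- exact/bounded_mfun_integrable/bounded_mfun_sum.
Qed.

(** [f] agrees almost everywhere with its positive part, whose integral is nonnegative. *)
Lemma ae_ge0_Rintegral_ge0 {d} {T : measurableType d} {R : realType}
    (mu : {finite_measure set T -> \bar R}) (f : T -> R) :
  measurable_fun setT f -> {ae mu, forall t, 0 <= f t} -> 0 <= \int[mu]_t f t.
Proof.
move=> mf f0; have -> : \int[mu]_t f t = \int[mu]_t Num.max (f t) 0.
  congr fine; apply: ae_eq_integral => //.
  - exact/measurable_EFinP.
  - exact/measurable_EFinP/measurable_maxr.
  - by apply: filterS f0 => t ft _; rewrite max_l.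
by apply: Rintegral_ge0 => t _; rewrite le_max lexx orbT.
Qed.

Lemma Rintegral_eq0_ae {d} {T : measurableType d} {R : realType}
    (mu : {finite_measure set T -> \bar R}) (f : T -> R) :
  bounded_mfun f -> (forall t, 0 <= f t) -> \int[mu]_t f t <= 0 ->
  {ae mu, forall t, f t = 0}.
Proof.
move=> bf f0 If; have mf : measurable_fun setT (EFin \o f).
  by apply/measurable_EFinP; case: bf.
have [+ _] := ae_eq_integral_abs mu measurableT mf.
have -> : (\int[mu]_x `|(EFin \o f) x| = (\int[mu]_x f x)%:E)%E.
  under eq_integral do rewrite gee0_abs ?lee_fin//.
  rewrite fineK//; apply: integrable_fin_num => //.
  exact: bounded_mfun_integrable.
have -> : \int[mu]_x f x = 0 by apply/eqP; rewrite eq_le If Rintegral_ge0.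
by move=> /(_ erefl); apply: filterS => t /(_ I) [].
Qed.

(** * Countable density, coordinates and normal cones *)

Lemma dense_rat_cV {R : realType} {m : nat} :
  dense [set map_mx (ratr : rat -> R) q | q in [set: 'cV[rat]_m]].
Proof.
move=> O [x Ox] oO.
have /nbhs_ballP[e /= e0 eO] : nbhs x O by exact: open_nbhs_nbhs.
have rq i : {q : rat | ball (x i ord0) e (ratr q : R)}.
  apply: cid; have [||r [xr [q _ qr]]] := @dense_rat R (ball (x i ord0) e).
  - by exists (x i ord0); exact: ballxx.
  - exact: ball_open.
  - by exists q; rewrite qr.
exists (map_mx ratr (\col_i sval (rq i))); split; last by exists (\col_i sval (rq i)).
by apply: eO; split => // i j; rewrite ord1 !mxE; exact: (svalP (rq i)).
Qed.

(** Reduces a closed condition on the body to countably many points. Rational points are taken in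
    the open set [D], where they are dense; the boundary of the body may contain none. *)
Lemma closure_open_rat {R : realType} {m : nat} (D P : set 'cV[R]_m) :
  open D -> closed P ->
  (forall q : 'cV[rat]_m, D (map_mx ratr q) -> P (map_mx ratr q)) ->
  closure D `<=` P.
Proof.
move=> oD clP DP x Dx; apply: clP => B.
rewrite nbhsE => -[U [oU Ux] UB].
have [||v [[Dq Uq] [q _ qE]]] := @dense_rat_cV R m (D `&` U).
- exact: (Dx U (open_nbhs_nbhs (conj oU Ux))).
- exact: openI.
- by rewrite -qE in Dq Uq; exists (map_mx ratr q); split; [exact: DP|exact: UB].
Qed.

Lemma closed_half_space {R : realType} {m : nat} (f a : 'cV[R]_m) :
  closed [set s | dot f (s - a) <= 0].
Proof.
have cf : continuous (fun s : 'cV[R]_m => dot f (s - a)).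
  move=> s; have cs : continuous (fun y : 'cV[R]_m => y - a) by exact: continuous_subr.
  have cc : {for s, continuous (fun=> f : 'cV[R]_m)} by exact: cst_continuous.
  exact (continuous_dot _ _ _ _ cc (cs s)).
exact: (preimage_closed (fun s _ => cf s) (@closed_le R 0)).
Qed.

Lemma measurable_coord {R : realType} {m : nat} (i : 'I_m) :
  measurable_fun setT (fun v : borel 'cV[R]_m => (v : 'cV[R]_m) i ord0).
Proof.
apply: (measurability _ (RGenOpens.measurableE R)).
move=> _ [_ [x [y ->]] <-]; rewrite setTI; apply: sub_sigma_algebra.
have /continuousP : continuous (fun v : 'cV[R]_m => v i ord0) by exact: coord_continuous.
by apply; exact: interval_open.
Qed.

Lemma coord_le_norm {R : realType} {m n : nat} (A : 'M[R]_(m, n)) i j :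
  `|A i j| <= `|A|.
Proof.
by rewrite [leRHS]/Num.norm /= mx_normrE; apply: (le_bigmax _ _ (i, j)).
Qed.

(** Coordinates of a unit vector are at most 1 in absolute value, so each of the [m * m] terms of
    the quadratic form is at most [M]. This bounds the eigenvalue function. *)
Lemma dot_le_of_coord {R : realType} {m : nat} (A : 'M[R]_m) (nu : 'cV[R]_m) (M : R) :
  dot nu nu = 1 -> (forall i j, `|A i j| <= M) ->
  `|dot nu (A *m nu)| <= M *+ (m * m).
Proof.
move=> nu1 AM; have nule i : `|nu i ord0| <= 1.
  rewrite -(ler_pXn2r (n := 2)) ?nnegrE// real_normK ?num_real// expr1n.
  by rewrite -nu1 coord_le_dot.
rewrite /dot; apply: le_trans (ler_norm_sum _ _ _) _.
have -> : M *+ (m * m) = \sum_(i < m) (M *+ m).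
  by rewrite sumr_const card_ord mulrnA.
apply: ler_sum => i _; rewrite normrM mxE.
rewrite -[leRHS]mul1r ler_pM//.
apply: le_trans (ler_norm_sum _ _ _) _.
have -> : M *+ m = \sum_(j < m) M by rewrite sumr_const card_ord.
by apply: ler_sum => j _; rewrite normrM -[leRHS]mulr1 ler_pM.
Qed.

(** A nonzero [f] of this kind, once normalised, is a unit outward normal at [a], hence equals [nu]
    by uniqueness. Pairing with the unit vector [nu] recovers the length of [f]; [f = 0] gives the
    coefficient 0. *)
Lemma normal_cone_smooth {R : realType} {m : nat} (S : set 'cV[R]_m)
    (a nu f : 'cV[R]_m) :
  is_normal_at S a nu -> (forall s, S s -> dot f (s - a) <= 0) ->
  f = Num.max (dot nu f) 0 *: nu.
Proof.
move=> [[nu1 _] uniq] fS; have [->|f0] := eqVneq f 0.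
  by rewrite -[X in dot nu X](scale0r 0) dotZr mul0r maxxx scale0r.
have ff := dot_gt0 _ f0; set r := Num.sqrt (dot f f).
have r0 : 0 < r by rewrite sqrtr_gt0.
have r2 : dot f f = r ^+ 2 by rewrite sqr_sqrtr ?ltW.
have nuE : r^-1 *: f = nu.
  apply: uniq; split=> [|s /fS fs].
    rewrite dotZl dotZr r2; field; exact: lt0r_neq0.
  by rewrite dotZl pmulr_rle0// invr_gt0.
have fE : f = r *: nu by rewrite -nuE scalerA divff ?scale1r// gt_eqF.
by rewrite {2}fE dotZr nu1 mulr1 max_l// ltW.
Qed.

(** * The integral transform and the two implications *)

Section TransformLemmas.
Context {R : realType} {m : nat} {X : Type} {Y : ptopologicalType}.
Context (mu : X -> {finite_measure set (borel Y) -> \bar R}).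
Context (K : X -> Y -> 'M[R]_m).
Context (K_mfun : forall x i j, bounded_mfun (fun y : borel Y => K x y i j)).
Context (integral_K : forall x, integral_mx mu K x = 1%:M).

Lemma bounded_mfun_mulmx (x : X) (u : Y -> 'cV[R]_m) (i : 'I_m) :
  (forall j, bounded_mfun (fun y : borel Y => u y j ord0)) ->
  bounded_mfun (fun y : borel Y => (K x y *m u y) i ord0).
Proof.
move=> bu; under eq_fun do rewrite mxE.
by apply: bounded_mfun_sum => j; exact: bounded_mfunM.
Qed.

Lemma bounded_mfun_dot_mulmx (x : X) (u : Y -> 'cV[R]_m) (nu : 'cV[R]_m) :
  (forall j, bounded_mfun (fun y : borel Y => u y j ord0)) ->
  bounded_mfun (fun y : borel Y => dot nu (K x y *m u y)).
Proof.
move=> bu; apply: bounded_mfun_sum => i; apply: bounded_mfunM.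
- exact: bounded_mfun_cst.
- exact: bounded_mfun_mulmx.
Qed.

Lemma dot_transform (x : X) (u : Y -> 'cV[R]_m) (nu : 'cV[R]_m) :
  (forall j, bounded_mfun (fun y : borel Y => u y j ord0)) ->
  dot nu (transform mu K u x) = \int[mu x]_y dot nu (K x y *m u y).
Proof.
move=> bu; rewrite /dot Rintegral_sum => [|i]; last first.
  by apply: bounded_mfunM; [exact: bounded_mfun_cst|exact: bounded_mfun_mulmx].
apply: eq_bigr => i _; rewrite mxE -RintegralZl//.
exact/bounded_mfun_integrable/bounded_mfun_mulmx.
Qed.

Lemma transform_cst (x : X) (a : 'cV[R]_m) : transform mu K (fun=> a) x = a.
Proof.
have {2}-> : a = integral_mx mu K x *m a by rewrite integral_K mul1mx.
apply/matrixP => i j; rewrite ord1 !mxE.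
under eq_Rintegral do rewrite mxE.
rewrite Rintegral_sum => [|k]; last by apply: bounded_mfunM => //; exact: bounded_mfun_cst.
apply: eq_bigr => k _; rewrite mxE RintegralZr//.
exact/bounded_mfun_integrable.
Qed.

(** The identity behind both implications: [a] is itself the transform of the constant [a], so the
    difference goes under the integral, and [K x y] moves to the other factor as its transpose. *)
Lemma dot_transformB (x : X) (u : Y -> 'cV[R]_m) (nu a : 'cV[R]_m) :
  (forall j, bounded_mfun (fun y : borel Y => u y j ord0)) ->
  dot nu (transform mu K u x - a) =
  \int[mu x]_y dot ((K x y)^T *m nu) (u y - a).
Proof.
move=> bu; have ba j : bounded_mfun (fun _ : borel Y => a j ord0).
  exact: bounded_mfun_cst.
rewrite dotBr -{1}(transform_cst x a) !dot_transform// -RintegralB//.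
- by apply: eq_Rintegral => y _; rewrite !dot_mulmx -dotBr.
- exact/bounded_mfun_integrable/bounded_mfun_dot_mulmx.
- exact/bounded_mfun_integrable/bounded_mfun_dot_mulmx.
Qed.

Lemma bounded_mfun_dotB (x : X) (u : Y -> 'cV[R]_m) (nu a : 'cV[R]_m) :
  (forall j, bounded_mfun (fun y : borel Y => u y j ord0)) ->
  bounded_mfun (fun y : borel Y => dot ((K x y)^T *m nu) (u y - a)).
Proof.
move=> bu; under eq_fun do rewrite -dot_mulmx.
apply: bounded_mfun_dot_mulmx => j; under eq_fun do rewrite !mxE.
by apply: bounded_mfunD => //; exact: bounded_mfun_cst.
Qed.

Lemma bounded_mfun_coord (u : Y -> 'cV[R]_m) (j : 'I_m) :
  measurable_fun setT (u : borel Y -> borel 'cV[R]_m) -> bounded_fun u ->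
  bounded_mfun (fun y : borel Y => u y j ord0).
Proof.
move=> mu_ /bounded_fun_le[M uM]; split.
  exact: (measurableT_comp (measurable_coord j) mu_).
by exists M => y; rewrite (le_trans (coord_le_norm _ _ _)).
Qed.

Lemma invariant_of_normals_eigenvectors (S : set 'cV[R]_m)
    (g : X -> Y -> normals S -> R) :
  convex_body S -> (forall x y nu, 0 <= g x y nu) ->
  normals_are_eigenvectors mu K g -> invariant_body mu K S.
Proof.
move=> [D [[d Dd] oD _ cD SE]] g0 geig u mu_ bu uS x; apply: contrapT => Sz.
have bu' j := bounded_mfun_coord u j mu_ bu.
have Sd : interior S d.
  rewrite SE; apply: (@filterS _ (nbhs d) _ D); first exact: subset_closure.
  exact: open_nbhs_nbhs.
have clS : closed S by rewrite SE; exact: closed_closure.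
have cvS : convex_comb_closed S by rewrite SE; exact: convex_comb_closure.
(* A value of the transform outside [S] would make [dot nu (transform mu K u x - a)] positive, while
   it is the integral of an almost everywhere nonpositive function. *)
have [a [nu [sa na]]] := separation_by_smooth_point S d _ cvS clS Sd Sz.
rewrite dot_transformB//; apply/negP; rewrite -leNgt -oppr_ge0.
have Nn : normals S nu by exists a.
pose nu' : normals S := SigSub (mem_set Nn).
have bf := bounded_mfun_dotB x u nu a bu'.
rewrite -mulN1r -RintegralZl//; last exact: bounded_mfun_integrable.
apply: ae_ge0_Rintegral_ge0.
  by case: (bounded_mfunM _ _ (bounded_mfun_cst (-1)) bf).
apply: filterS (geig x nu') => y /= ->.
have [[_ naS] _] := na.
by rewrite mulN1r oppr_ge0 dotZl mulr_ge0_le0// naS.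
Qed.

(** For the two-valued test function [u] the integrand is the positive part of [phi]. Invariance
    makes its integral nonpositive, so this positive part vanishes almost everywhere. *)
Lemma invariant_ae_le0 (S : set 'cV[R]_m) (x : X) (nu a s : 'cV[R]_m) :
  invariant_body mu K S -> unit_outward_normal S a nu -> S a -> S s ->
  {ae mu x, forall y : borel Y, dot ((K x y)^T *m nu) (s - a) <= 0}.
Proof.
move=> invS [_ nuS] Sa Ss.
pose phi (y : borel Y) := dot ((K x y)^T *m nu) (s - a).
pose u (y : Y) := if 0 < phi y then s else a.
have bphi : bounded_mfun phi.
  by apply: (bounded_mfun_dotB x (fun=> s)) => j; exact: bounded_mfun_cst.
have mu_ : measurable_fun setT (u : borel Y -> borel 'cV[R]_m).
  apply: measurable_fun_ifT; [|exact: measurable_cst|exact: measurable_cst].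
  by apply: measurable_fun_ltr; [exact: measurable_cst|case: bphi].
have bu : bounded_fun u.
  exists (Num.max `|s| `|a|); split; first exact: num_real.
  move=> M sM y _ /=; apply: le_trans (ltW sM).
  by rewrite /u; case: ifP => _; rewrite le_max lexx ?orbT.
have bu' j := bounded_mfun_coord u j mu_ bu.
have Su : forall y, S (u y) by move=> y; rewrite /u; case: ifP.
have /nuS := invS u mu_ bu Su x; rewrite dot_transformB// => If.
have uE y : dot ((K x y)^T *m nu) (u y - a) = Num.max (phi y) 0.
  rewrite /u; have [//|_] := ltP 0 (phi y).
  by rewrite subrr -[X in dot _ X](scale0r 0) dotZr mul0r.
have bf := bounded_mfun_dotB x u nu a bu'.
have : {ae mu x, forall y : borel Y, dot ((K x y)^T *m nu) (u y - a) = 0}.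
  apply: Rintegral_eq0_ae => // y.
  by rewrite uE le_max lexx orbT.
by apply: filterS => y; rewrite uE => <-; rewrite le_max lexx.
Qed.

Lemma normals_eigenvectors_of_invariant (S : set 'cV[R]_m) :
  convex_body S -> invariant_body mu K S ->
  normals_are_eigenvectors mu K
    (fun x y (nu : normals S) => Num.max (dot (\val nu) (K x y *m \val nu)) 0).
Proof.
move=> [D [_ oD _ _ SE]] invS x [nu /set_mem [a [bda _] na]] /=.
have clS : closed S by rewrite SE; exact: closed_closure.
have Sa : S a by case: bda => /clS.
have [na1 _] := na.
(* Rational columns are enumerated by their codes, so that one null set serves all of them; numbers
   coding nothing impose the condition [True]. *)
pose P (k : nat) (y : borel Y) :=
  if unpickle k is Some q then
    D (map_mx ratr q) -> dot ((K x y)^T *m nu) (map_mx ratr q - a) <= 0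
  else True.
have : {ae mu x, forall y : borel Y, forall k, P k y}.
  apply: ae_foralln => k; rewrite /P; case: unpickle => [q|]; last exact: aeW.
  have [Dq|nDq] := pselect (D (map_mx ratr q)); last by apply: aeW.
  have Sq : S (map_mx ratr q) by rewrite SE; exact: subset_closure.
  by apply: filterS (invariant_ae_le0 S x nu a _ invS na1 Sa Sq).
apply: filterS => y Py; rewrite dot_mulmx dotC.
apply: (normal_cone_smooth S a) => // s; rewrite SE.
apply: (closure_open_rat D [set s | dot ((K x y)^T *m nu) (s - a) <= 0]) => //.
- exact: closed_half_space.
- by move=> q Dq; have := Py (pickle q); rewrite /P pickleK; exact.
Qed.

End TransformLemmas.

(** The bounds on [K x] may depend on [x], and the first equivalence bounds [g] for each [x]
    accordingly; the second derives a bound uniform in [x] from one on [K]. *)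
Theorem proposition1 (R : realType) (m : nat) (X : Type) (Y : ptopologicalType)
    (mu : X -> {finite_measure set (borel Y) -> \bar R})
    (K : X -> Y -> 'M[R]_m) (S : set 'cV[R]_m)
    (locally_compact_Y : locally_compact [set: Y])
    (hausdorff_Y : hausdorff_space Y)
    (regular_mu : forall x, regular_measure (mu x))
    (measurable_K : forall x i j,
      measurable_fun setT (fun y : borel Y => K x y i j))
    (bounded_K : forall x i j, bounded_fun (fun y => K x y i j))
    (integral_K : forall x, integral_mx mu K x = 1%:M)
    (convex_body_S : convex_body S) :
  (invariant_body mu K S <->
    exists g : X -> Y -> normals S -> R,
      [/\ forall x y nu, 0 <= g x y nu,
          forall x, bounded_fun (fun p : Y * normals S => g x p.1 p.2)
        & normals_are_eigenvectors mu K g])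
  /\
  (bounded_fun (fun p : X * Y => K p.1 p.2) ->
    (invariant_body mu K S <->
      exists g : X -> Y -> normals S -> R,
        [/\ forall x y nu, 0 <= g x y nu,
            bounded_fun (fun p : X * Y * normals S => g p.1.1 p.1.2 p.2)
          & normals_are_eigenvectors mu K g])).
Proof.
have K_mfun x i j : bounded_mfun (fun y : borel Y => K x y i j).
  by split; [exact: measurable_K|exact: bounded_fun_le].
(* Pairing the eigenvector equation with the unit vector [nu] gives the eigenvalue as
   [dot nu (K x y *m nu)]; the maximum with 0 keeps [g] nonnegative on the exceptional null sets
   too. *)
pose g x y (nu : normals S) := Num.max (dot (\val nu) (K x y *m \val nu)) 0.
have g0 x y nu : 0 <= g x y nu by rewrite le_max lexx orbT.
have g_le x y nu M : (forall i j, `|K x y i j| <= M) -> `|g x y nu| <= M *+ (m * m).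
  move=> KM; case: nu => [nu nuN]; have /set_mem[a _ [[nu1 _] _]] := nuN.
  rewrite ger0_norm// ge_max; apply/andP.
  have := dot_le_of_coord (K x y) nu M nu1 KM.
  by move=> le; split; [exact: le_trans (ler_norm _) le|exact: le_trans le].
have bounded_of_le (T : Type) (f : T -> R) M : (forall t, `|f t| <= M) -> bounded_fun f.
  move=> fM; exists M; split; first exact: num_real.
  by move=> N MN t _ /=; rewrite (le_trans (fM t))// ltW.
have g_eig : invariant_body mu K S -> normals_are_eigenvectors mu K g.
  exact: normals_eigenvectors_of_invariant.
split; [split|move=> bK; split].
- move=> /g_eig eig; exists g; split => // x.
  have /choice[M KM] ij : exists M, forall y, `|K x y ij.1 ij.2| <= M.
    exact: bounded_fun_le (bounded_K x ij.1 ij.2).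
  (* The sum of the entrywise bounds is a single bound valid for every entry of [K x y]. *)
  apply: (bounded_of_le _ _ ((\sum_ij `|M ij|) *+ (m * m))) => -[y nu] /=.
  apply: g_le => i j; rewrite (le_trans (KM (i, j) y))// (le_trans (ler_norm _))//.
  by rewrite (bigD1 (i, j))//= lerDl sumr_ge0.
- by move=> [g' [g'0 _ eig]]; exact: invariant_of_normals_eigenvectors eig.
- move=> /g_eig eig; exists g; split => //.
  have [M KM] := bounded_fun_le _ bK.
  apply: (bounded_of_le _ _ (M *+ (m * m))) => -[[x y] nu] /=.
  apply: g_le => i j; exact: le_trans (coord_le_norm _ _ _) (KM (x, y)).
- by move=> [g' [g'0 _ eig]]; exact: invariant_of_normals_eigenvectors eig.
Qed.
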